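(* Let $\mathbb K$ be a field of characteristic $p>2$, $n,r\ge1$, $a,\kappa\in\mathbb K^\times$, $\Lambda_1,\dots,\Lambda_n\in\mathbb K$, and $h_p(y)=y^p-a^{p-1}y$. Then, as rational functions of $s=(s_1,\dots,s_r)$ and $x=(x_1,\dots,x_n)$ over $\mathbb K$, $$\tilde\Phi_l(s,x)=\kappa^p\prod_{i=1}^n\frac{h_p(s_l)-h_p(x_i)+h_p(\Lambda_i)}{h_p(s_l)-h_p(x_i)}\cdot\prod_{j\ne l}\frac{h_p(s_l)-h_p(s_j)-h_p(1)}{h_p(s_l)-h_p(s_j)+h_p(1)},\qquad l=1,\dots,r,$$ $$\tilde\Psi_m(s,x)=\prod_{l=1}^r\frac{h_p(s_l)-h_p(x_m)}{h_p(s_l)-h_p(x_m)+h_p(\Lambda_m)},\qquad m=1,\dots,n.$$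
   Context: The rational functions $\Phi_l$, $\Psi_m$ over $\mathbb K$ are $$\Phi_l(s,x)=\kappa\prod_{i=1}^n\frac{s_l-x_i+\Lambda_i}{s_l-x_i+a}\prod_{j\ne l}\frac{(s_l-s_j+a)(s_l-s_j-1)}{(s_l-s_j)(s_l-s_j+1+a)},\qquad \Psi_m(s,x)=\prod_{j=1}^r\frac{s_j-x_m}{s_j-x_m+\Lambda_m-a}.$$ Their scalar $p$-curvature functions are $\tilde\Phi_l(s,x)=\prod_{i=0}^{p-1}\Phi_l(s+iae_l,x)$ and $\tilde\Psi_m(s,x)=\prod_{i=0}^{p-1}\Psi_m(s,x+iaf_m)$, where $s+iae_l$ (resp. $x+iaf_m$) is $s$ (resp. $x$) with the $l$-th (resp. $m$-th) coordinate increased by $ia$. *)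

(* Defs.v *)
From HB Require Import structures.
From mathcomp Require Import all_boot all_order all_algebra.
From mathcomp Require Import mpoly.

Set Implicit Arguments.
Unset Strict Implicit.
Unset Printing Implicit Defensive.

Import GRing.Theory.
Local Open Scope ring_scope.

(* The field K(s_1, ..., s_r, x_1, ..., x_n); the first r indeterminates of
   K[r + n] are the s_j and the last n are the x_i. *)
Definition ratfun (K : fieldType) (r n : nat) : fieldType :=
  {fraction {mpoly K[r + n]}}.

Definition cst (K : fieldType) (r n : nat) (c : K) : ratfun K r n :=
  tofrac (c%:MP_[r + n]).

Definition svar (K : fieldType) (r n : nat) (j : 'I_r) : ratfun K r n :=
  tofrac ('X_(lshift n j) : {mpoly K[r + n]}).

Definition xvar (K : fieldType) (r n : nat) (i : 'I_n) : ratfun K r n :=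
  tofrac ('X_(rshift r i) : {mpoly K[r + n]}).

Definition shift (F : fieldType) (d : nat) (v : 'I_d -> F) (l : 'I_d) (c : F) :
    'I_d -> F :=
  fun j => if j == l then v j + c else v j.

Definition hp (F : fieldType) (p : nat) (a y : F) : F :=
  y ^+ p - a ^+ p.-1 * y.

(* Phi and Psi take arbitrary points s, x with coordinates in a field F, so that
   Phi_l(s + i a e_l, x) is obtained by substitution.  Taking F = K(s, x) and
   the coordinates svar, xvar gives the rational functions themselves; there,
   also after shifting a coordinate by a constant, every denominator is a
   product of nonzero linear polynomials, so the convention 0^-1 = 0 plays no
   role. *)
Definition Phi (F : fieldType) (r n : nat) (kappa a : F) (Lambda : 'I_n -> F)
    (l : 'I_r) (s : 'I_r -> F) (x : 'I_n -> F) : F :=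
  kappa
  * (\prod_(i < n) ((s l - x i + Lambda i) / (s l - x i + a)))
  * (\prod_(j < r | j != l)
       (((s l - s j + a) * (s l - s j - 1))
        / ((s l - s j) * (s l - s j + 1 + a)))).

Definition Psi (F : fieldType) (r n : nat) (a : F) (Lambda : 'I_n -> F)
    (m : 'I_n) (s : 'I_r -> F) (x : 'I_n -> F) : F :=
  \prod_(j < r) ((s j - x m) / (s j - x m + Lambda m - a)).

Definition tPhi (F : fieldType) (p r n : nat) (kappa a : F) (Lambda : 'I_n -> F)
    (l : 'I_r) (s : 'I_r -> F) (x : 'I_n -> F) : F :=
  \prod_(0 <= i < p) Phi kappa a Lambda l (shift s l (i%:R * a)) x.

Definition tPsi (F : fieldType) (p r n : nat) (a : F) (Lambda : 'I_n -> F)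
    (m : 'I_n) (s : 'I_r -> F) (x : 'I_n -> F) : F :=
  \prod_(0 <= i < p) Psi a Lambda m s (shift x m (i%:R * a)).

(* Main.v *)
(** In characteristic p the polynomial h(y) = y^p - a^(p-1) y is additive and
    equals the product of the y + i a for i in F_p; in particular h(a) = 0.  So
    the p shifts turn each linear factor y + c of Phi and Psi into h(y) + h(c),
    and the factors s_l - s_j + a and s_l - s_j of Phi_l both become
    h(s_l) - h(s_j), which is nonzero and cancels. *)
Require Import Defs.
From HB Require Import structures.
From mathcomp Require Import all_boot all_order all_algebra.
From mathcomp Require Import mpoly.

Set Implicit Arguments.
Unset Strict Implicit.
Unset Printing Implicit Defensive.

Import GRing.Theory.
Local Open Scope ring_scope.

Section ScalarPCurvature.

Variables (F : fieldType) (p : nat) (a : F).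
Hypotheses (charFp : p \in [pchar F]) (a_neq0 : a != 0).

Local Notation h := (hp p a).

Let p_gt1 : (1 < p)%N.
Proof. exact: prime_gt1 (pcharf_prime charFp). Qed.

Lemma hpD : {morph h : y z / y + z}.
Proof.
move=> y z; rewrite /hp -!(pFrobenius_autE charFp) rmorphD mulrDr opprD.
by rewrite addrACA.
Qed.

Lemma hpN : {morph h : y / - y}.
Proof.
by move=> y; rewrite /hp -!(pFrobenius_autE charFp) rmorphN mulrN opprB opprK addrC.
Qed.

Lemma hpB : {morph h : y z / y - z}.
Proof. by move=> y z; rewrite hpD hpN. Qed.

(** Frobenius fixes the prime field, so [(i a)^p = i a^p = a^(p-1) (i a)]. *)
Lemma hp_natM i : h (i%:R * a) = 0.
Proof.
rewrite /hp exprMn -(pFrobenius_autE charFp i%:R) pFrobenius_aut_nat.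
by rewrite mulrCA -exprSr prednK ?subrr // ltnW.
Qed.

Lemma hp_id : h a = 0.
Proof. by have := hp_natM 1; rewrite mul1r. Qed.

(* The monic polynomial X^p - a^(p-1) X has the p distinct roots i * a. *)
Lemma prod_subr_hp (y : F) : \prod_(0 <= i < p) (y - i%:R * a) = h y.
Proof.
pose P : {poly F} := 'X^p - (a ^+ p.-1) *: 'X.
have sizeX : (size ((a ^+ p.-1) *: 'X : {poly F}) < size ('X^p : {poly F}))%N.
  by rewrite size_polyXn (leq_ltn_trans (size_scale_leq _ _)) // size_polyX ltnS.
have sizeP : size P = p.+1 by rewrite size_polyDl ?size_polyN // size_polyXn.
have monP : lead_coef P = 1 by rewrite lead_coefDl ?size_polyN // lead_coefXn.
have hornerP z : P.[z] = h z by rewrite !hornerE.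
pose rs := [seq i%:R * a | i <- index_iota 0 p].
have rootP : all (root P) rs.
  by apply/allP=> _ /mapP[i _ ->]; rewrite rootE hornerP hp_natM.
(* Since [a] is invertible, [i a = j a] with [i <= j < p] forces [p] to divide [j - i < p]. *)
have uniq_rs : uniq rs.
  rewrite map_inj_in_uniq ?iota_uniq // => i j.
  rewrite !mem_index_iota /= => i_ltp j_ltp /(mulIf a_neq0) eq_ij.
  wlog le_ij : i j i_ltp j_ltp eq_ij / (i <= j)%N.
    by case/orP: (leq_total i j) => ? wl; [|symmetry]; apply: wl.
  apply/eqP; rewrite eqn_leq le_ij /= -subn_eq0.
  have : (p %| j - i)%N by rewrite (dvdn_pcharf charFp) natrB // eq_ij subrr.
  apply: contraLR; rewrite -lt0n => ij_gt0.
  by rewrite gtnNdvd // (leq_ltn_trans (leq_subr _ _)).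
rewrite -hornerP (all_roots_prod_XsubC _ rootP) ?uniq_rootsE //; last first.
  by rewrite sizeP size_map size_iota subn0.
rewrite monP scale1r big_map horner_prod.
by apply: eq_bigr => i _; rewrite hornerXsubC.
Qed.


Lemma prod_addr_hp (y : F) : \prod_(0 <= i < p) (y + i%:R * a) = h y.
Proof.
(* Reversing the index turns [y + i a] into [y + (p - 1 - i) a = (y - a) - i a], and
   [h (y - a) = h y] because [h a = 0]. *)
rewrite big_nat_rev -[RHS]subr0 -hp_id -hpB -prod_subr_hp !big_mkord.
apply: eq_bigr => i _; rewrite add0n natrB // (pcharf0 charFp) sub0r.
by rewrite mulNr -natr1 mulrDl mul1r opprD addrA addrAC.
Qed.

Section Coordinates.

Variables (r n : nat) (s : 'I_r -> F) (x L : 'I_n -> F).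

(** The hypothesis allows cancelling [h (s l) - h (s j)], which arises both from the factor
    [s l - s j + a] above and from [s l - s j] below. *)
Lemma tPhi_hp (kappa : F) (l : 'I_r) :
    (forall j, j != l -> h (s l) - h (s j) != 0) ->
  tPhi p kappa a L l s x
  = kappa ^+ p
    * (\prod_(i < n) ((h (s l) - h (x i) + h (L i)) / (h (s l) - h (x i))))
    * (\prod_(j < r | j != l)
         ((h (s l) - h (s j) - h 1) / (h (s l) - h (s j) + h 1))).
Proof.
move=> hs_neq; rewrite /tPhi /Phi !big_split /= prodr_const_nat subn0.
congr (_ * _ * _); rewrite exchange_big -big_split /=; apply: eq_bigr => k.
  move=> _; rewrite prodf_div; congr (_ / _).
    rewrite -hpB -hpD -prod_addr_hp; apply: eq_bigr => i _.
    by rewrite /shift eqxx !(addrAC _ (i%:R * a)).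
  (* The constant [a] in this denominator contributes [h a = 0]. *)
  rewrite -[RHS]addr0 -hp_id -hpB -hpD -prod_addr_hp; apply: eq_bigr => i _.
  by rewrite /shift eqxx !(addrAC _ (i%:R * a)).
move=> k_neql; have shiftk i : shift s l (i%:R * a) l - shift s l (i%:R * a) k
    = s l - s k + i%:R * a by rewrite /shift eqxx (negPf k_neql) addrAC.
under eq_bigr do rewrite shiftk.
rewrite prodf_div !big_split /=.
have shift_prod c : \prod_(0 <= i < p) (s l - s k + i%:R * a + c)
    = h (s l) - h (s k) + h c.
  rewrite -hpB -hpD -prod_addr_hp; apply: eq_bigr => i _.
  by rewrite addrAC.
rewrite !shift_prod prod_addr_hp.
(* Grouping [1 + a] as one constant lets [shift_prod] apply; then [h (1 + a) = h 1]. *)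
under [X in _ / (_ * X)]eq_bigr do rewrite -addrA.
by rewrite shift_prod hpB hpD hp_id !addr0 hpN -mulf_div divff ?mul1r ?hs_neq.
Qed.

Lemma tPsi_hp (m : 'I_n) :
  tPsi p a L m s x
  = \prod_(l < r) ((h (s l) - h (x m)) / (h (s l) - h (x m) + h (L m))).
Proof.
rewrite /tPsi /Psi exchange_big /=; apply: eq_bigr => j _.
rewrite prodf_div; congr (_ / _).
  (* Raising [x m] by [i a] lowers [s j - x m] by [i a], hence the product with minus signs. *)
  rewrite -hpB -prod_subr_hp; apply: eq_bigr => i _.
  by rewrite /shift eqxx opprD addrA.
rewrite -[RHS]subr0 -hp_id -hpB -hpD -hpB -prod_subr_hp; apply: eq_bigr => i _.
by rewrite /shift eqxx opprD addrA !(addrAC _ (- (i%:R * a))).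
Qed.

End Coordinates.

End ScalarPCurvature.

(** The coefficient of the indeterminate [s_l] in this linear polynomial is 1, as [j != l]. *)
Lemma svar_sub_cst_neq0 (K : fieldType) (r n : nat) (l j : 'I_r) (c : K) :
  j != l -> @svar K r n l - @svar K r n j - @cst K r n c != 0.
Proof.
move=> j_neql; rewrite /svar /cst -!rmorphB tofrac_eq0.
apply/eqP => /(congr1 (mcoeff U_(lshift n l))) /eqP.
rewrite !mcoeffB mcoeff0 !mcoeffXU eqxx mcoeffC.
by rewrite (inj_eq (@lshift_inj _ _)) (negPf j_neql) mnm1_eq0 mulr0 !subr0 oner_eq0.
Qed.

Theorem lemma5p3 (K : fieldType) (p : nat) (hp_char : p \in [pchar K])
    (hp2 : (2 < p)%N) (n r : nat) (hn : (0 < n)%N) (hr : (0 < r)%N)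
    (a kappa : K) (ha : a != 0) (hkappa : kappa != 0) (Lambda : 'I_n -> K) :
  let C : K -> ratfun K r n := @cst K r n in
  let s : 'I_r -> ratfun K r n := @svar K r n in
  let x : 'I_n -> ratfun K r n := @xvar K r n in
  let L : 'I_n -> ratfun K r n := fun i => C (Lambda i) in
  let h : ratfun K r n -> ratfun K r n := hp p (C a) in
  (forall l : 'I_r,
     tPhi p (C kappa) (C a) L l s x
     = C kappa ^+ p
       * (\prod_(i < n) ((h (s l) - h (x i) + h (L i)) / (h (s l) - h (x i))))
       * (\prod_(j < r | j != l)
            ((h (s l) - h (s j) - h 1) / (h (s l) - h (s j) + h 1))))
  /\
  (forall m : 'I_n,
     tPsi p (C a) L m s x
     = \prod_(l < r) ((h (s l) - h (x m)) / (h (s l) - h (x m) + h (L m)))).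
Proof.
rewrite /=.
(* The characteristic passes from [K] to its polynomial ring and on to the fraction field. *)
have charF : p \in [pchar ratfun K r n].
  apply: (rmorph_pchar (@tofrac {mpoly K[r + n]})).
  exact: (rmorph_pchar (@mpolyC (r + n) K)).
have Ca_neq0 : @cst K r n a != 0 by rewrite tofrac_eq0 mpolyC_eq0.
split=> [l|m]; last exact: tPsi_hp.
apply: tPhi_hp => // j j_neql.
(* The difference is [h (s_l - s_j)], the product of the [s_l - s_j - i a], each a nonzero linear
   polynomial. *)
rewrite -(hpB _ charF) -prod_subr_hp // prodf_seq_neq0.
apply/allP => i _ /=.
have -> : i%:R * @cst K r n a = @cst K r n (i%:R * a).
  by rewrite /cst !rmorphM !rmorph_nat.
exact: svar_sub_cst_neq0.
Qed.
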